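(* For $\alpha \in (0,d)$ and $\epsilon \in(0, \alpha]$, there exists a constant $C=C(\alpha,\epsilon)>0$ such that $$\|I_\alpha \mu \|_{BMO^{d-\alpha+\epsilon}(\mathbb{R}^d)} \leq C \|\mu\|_{\mathcal{M}^{d-\alpha}(\mathbb{R}^d)}$$ for all $\mu \in \mathcal{M}^{d-\alpha}(\mathbb{R}^d)$ such that $I_\alpha \mu \in L^1(K;\mathcal{H}^{d-\alpha+\epsilon}_\infty)$ for all compact sets $K \subset \mathbb{R}^d$.
   Context: For $\beta\in(0,d]$: $\mathcal{H}^{\beta}_{\infty}(E)= \inf \{\sum_{i} \omega_\beta r_i^\beta : E \subset \bigcup_{i} B(x_i,r_i) \}$, $\omega_\beta= \pi^{\beta/2}/\Gamma(\beta/2+1)$. $f$ is $\mathcal{H}^\beta_\infty$-quasicontinuous if for every $\eta>0$ there is an open $O$ with $\mathcal{H}^\beta_\infty(O)<\eta$ and $f|_{O^c}$ continuous. Choquet integral: $\int_A f\,d\mathcal{H}^\beta_\infty=\int_0^\infty \mathcal{H}^\beta_\infty(\{x\in A: f(x)>t\})\,dt$ for $f\ge0$; $L^1(K;\mathcal{H}^\beta_\infty)$ is the set of quasicontinuous $f$ with $\int_K|f|\,d\mathcal{H}^\beta_\infty<\infty$. $\|u\|_{BMO^{\beta}(\mathbb{R}^d)}= \sup_{Q} \inf_{c \in \mathbb{R}} l(Q)^{-\beta} \int_{Q} |u-c| \,d\mathcal{H}^{\beta}_\infty$, the supremum over all finite cubes $Q\subset\mathbb{R}^d$ with sides parallel to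 the coordinate axes, $l(Q)$ the side length. $\mathcal{M}^{\beta}(\mathbb{R}^d)$ is the space of locally finite signed Radon measures $\nu$ with $\|\nu\|_{\mathcal{M}^\beta}=\sup_{x\in\mathbb{R}^d,r>0} |\nu|(B(x,r))/r^\beta<\infty$. The Riesz potential is $I_\alpha \mu(x)= \frac{1}{\gamma(\alpha)} \int_{\mathbb{R}^d} \frac{d\mu(y)}{|x-y|^{d-\alpha}}$ with $\gamma(\alpha)>0$ the standard normalization constant. *)

(* Defs.v *)
From HB Require Import structures.
From mathcomp Require Import all_boot all_order all_algebra.
From mathcomp Require Import all_classical all_reals all_analysis.

Set Implicit Arguments.
Unset Strict Implicit.
Unset Printing Implicit Defensive.

Import Order.TTheory GRing.Theory Num.Theory.
Import numFieldNormedType.Exports.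

Local Open Scope classical_set_scope.
Local Open Scope ring_scope.

Section Defs.
Variables (R : realType) (d : nat).

Local Notation Rd := 'rV[R]_d.

Definition enorm (x : Rd) : R := Num.sqrt (\sum_(i < d) (x ord0 i) ^+ 2).

Definition eball (x : Rd) (r : R) : set Rd := [set y | enorm (y - x) < r].

Definition cube (a : Rd) (l : R) : set Rd :=
  [set y | forall i : 'I_d, a ord0 i <= y ord0 i <= a ord0 i + l].

Definition gammaR (s : R) : R :=
  fine (\int[@lebesgue_measure R]_(t in `]0%R, +oo[) (powR t (s - 1) * expR (- t))%:E)%E.

Definition omega (beta : R) : R := powR pi (beta / 2) / gammaR (beta / 2 + 1).

Definition hcontent (beta : R) (E : set Rd) : \bar R :=
  ereal_inf [set v : \bar R | exists c : nat -> Rd * R,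
     (forall i, 0 <= (c i).2) /\
     E `<=` \bigcup_i eball (c i).1 (c i).2 /\
     v = (\sum_(0 <= i <oo) (omega beta * powR (c i).2 beta)%:E)%E].

Definition choquet (beta : R) (A : set Rd) (f : Rd -> \bar R) : \bar R :=
  (\int[@lebesgue_measure R]_(t in `[0%R, +oo[)
      hcontent beta [set x | A x /\ (t%:E < f x)%E])%E.

Definition quasicontinuous_on (beta : R) (K : set Rd) (f : Rd -> \bar R) : Prop :=
  forall eta : R, 0 < eta -> exists O : set Rd,
    open O /\ (hcontent beta O < eta%:E)%E /\
    (forall x, (K `\` O) x -> f x \is a fin_num) /\
    {within K `\` O, continuous (fun x => fine (f x))}.

Definition L1_content (beta : R) (K : set Rd) (f : Rd -> \bar R) : Prop :=
  quasicontinuous_on beta K f /\ (choquet beta K (fun x => `|f x|%E) < +oo)%E.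

Definition bmo_norm (beta : R) (u : Rd -> \bar R) : \bar R :=
  ereal_sup [set v : \bar R | exists (a : Rd) (l : R), 0 < l /\
     v = ereal_inf [set w : \bar R | exists c : R,
            w = ((powR l (- beta))%:E * choquet beta (cube a l) (fun x => `|u x - c%:E|))%E]].

Definition BorelRd := g_sigma_algebraType (@open Rd).

(* A locally finite signed Radon measure nu on R^d, given through its Jordan
   decomposition nu = mup - mun (mup, mun locally finite, mutually singular
   positive Borel measures); its total variation is |nu| = mup + mun. *)
Definition signed_radon (mup mun : {measure set BorelRd -> \bar R}) : Prop :=
  (forall (x : Rd) (r : R), (mup (eball x r) < +oo)%E /\ (mun (eball x r) < +oo)%E) /\
  (exists P : set BorelRd, measurable P /\ mup (~` P) = 0%E /\ mun P = 0%E).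

Definition morrey_norm (beta : R) (mup mun : {measure set BorelRd -> \bar R}) : \bar R :=
  ereal_sup [set v : \bar R | exists (x : Rd) (r : R), 0 < r /\
     v = ((mup (eball x r) + mun (eball x r)) * (powR r (- beta))%:E)%E].

Definition riesz_const (alpha : R) : R :=
  powR pi (d%:R / 2) * powR 2 alpha * gammaR (alpha / 2) / gammaR ((d%:R - alpha) / 2).

Definition riesz_kernel (alpha : R) (x : Rd) (y : BorelRd) : \bar R :=
  (powR (enorm (x - y)) (alpha - d%:R))%:E.

(* I_alpha nu (x) = (1/gamma(alpha)) (int k(x,y) dmup(y) - int k(x,y) dmun(y)),
   an extended real (infinite exactly where the potential is not defined/finite) *)
Definition riesz_potential (alpha : R) (mup mun : {measure set BorelRd -> \bar R})
  (x : Rd) : \bar R :=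
  ((riesz_const alpha)^-1%:E *
    (\int[mup]_y riesz_kernel alpha x y - \int[mun]_y riesz_kernel alpha x y))%E.

End Defs.

(* Main.v *)
(* Let s = d - alpha, b = s + eps, Q a cube, x0 a point of Q at which the
   potential is finite (if there is none, integrability of the potential on Q
   forces Q to have zero content), and r twice the diameter of Q.  Subtracting
   the part of the potential at x0 coming from the mass outside the ball
   B(x0, r) leaves two terms on Q.  The far one is bounded by a multiple of the
   Morrey norm m, by a dyadic decomposition and the mean value inequality for
   the kernel.  The near one is at most a multiple of
   sum_j r_j^(-s) |mu|(B(x, r_j)), where r_j = 2 r / 2^j; if it exceeds a
   multiple of lam m, then |mu|(B(x, r_j)) > lam m p^j r_j^s for some j, where
   p = 2^(-eps/3).  A maximal 2 r_j-separated set of such points has at most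
   |mu|(B(x0, 3 r)) / (lam m p^j r_j^s) elements, so that these points form a
   set of content at most a constant times r^b p^j / lam^2.  Summing over j,
   the level sets of the oscillation have content O(r^b / lam^2), which is
   integrable in lam. *)
Require Import Defs.
From HB Require Import structures.
From mathcomp Require Import all_boot all_order all_algebra.
From mathcomp Require Import all_classical all_reals all_analysis.
From mathcomp Require Import measurable_realfun.
From mathcomp Require Import ring lra.
Import Order.TTheory GRing.Theory Num.Theory.
Import numFieldNormedType.Exports.
Local Open Scope classical_set_scope.
Local Open Scope ring_scope.

(** * Euclidean norm, balls and cubes, and their measurability *)

Lemma enorm_ge0 {R : realType} {d : nat} (x : 'rV[R]_d) : 0 <= enorm x.
Proof. exact: sqrtr_ge0. Qed.

Lemma enormN {R : realType} {d : nat} (x : 'rV[R]_d) : enorm (- x) = enorm x.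
Proof. by congr Num.sqrt; apply: eq_bigr => i _; rewrite mxE sqrrN. Qed.

Lemma enorm_distC {R : realType} {d : nat} (x y : 'rV[R]_d) :
  enorm (x - y) = enorm (y - x).
Proof. by rewrite -enormN opprB. Qed.

Lemma sqr_enorm {R : realType} {d : nat} (x : 'rV[R]_d) :
  enorm x ^+ 2 = \sum_(i < d) x ord0 i ^+ 2.
Proof. by rewrite sqr_sqrtr// sumr_ge0// => i _; exact: sqr_ge0. Qed.

Lemma enorm_Cauchy_Schwarz {R : realType} {d : nat} (x y : 'rV[R]_d) :
  \sum_(i < d) x ord0 i * y ord0 i <= enorm x * enorm y.
Proof.
set p := \sum_(i < d) _.
have := enorm_ge0 x; have := enorm_ge0 y.
rewrite !le_eqVlt => /predU1P[y0|y0] /predU1P[x0|x0].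
1-3: rewrite -?x0 -?y0 ?mulr0 ?mul0r /p big1 ?eqxx// => i _.
1,2: have /eqP : enorm y ^+ 2 = 0 by rewrite -y0 expr0n.
3: have /eqP : enorm x ^+ 2 = 0 by rewrite -x0 expr0n.
1-3: rewrite sqr_enorm psumr_eq0; last by move=> j _; exact: sqr_ge0.
1-3: move=> /allP/(_ i (mem_index_enum _)); rewrite sqrf_eq0 => /eqP ->.
1-3: by rewrite ?mulr0 ?mul0r.
(* Both norms are now positive. This sum of squares expands to a positive multiple of
   [enorm x * enorm y - p]. *)
have : 0 <= \sum_(i < d) (enorm y * x ord0 i - enorm x * y ord0 i) ^+ 2.
  by apply: sumr_ge0 => i _; exact: sqr_ge0.
have -> : \sum_(i < d) (enorm y * x ord0 i - enorm x * y ord0 i) ^+ 2 =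
    2 * (enorm x * enorm y) * (enorm x * enorm y - p).
  transitivity (\sum_(i < d) (enorm y ^+ 2 * x ord0 i ^+ 2 +
      enorm x ^+ 2 * y ord0 i ^+ 2 -
      2 * (enorm x * enorm y) * (x ord0 i * y ord0 i))).
    by apply: eq_bigr => i _; ring.
  rewrite sumrB big_split/= -!mulr_sumr -!sqr_enorm -/p; ring.
rewrite pmulr_rge0 ?subr_ge0 ?le_eqVlt ?orbA// ?mulr_gt0//.
Qed.

Lemma enorm_triangle {R : realType} {d : nat} (x y : 'rV[R]_d) :
  enorm (x + y) <= enorm x + enorm y.
Proof.
rewrite -(@ler_pXn2r _ 2)// ?nnegrE ?addr_ge0 ?enorm_ge0// sqr_enorm.
have -> : \sum_(i < d) (x + y) ord0 i ^+ 2 =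
    enorm x ^+ 2 + enorm y ^+ 2 + 2 * \sum_(i < d) x ord0 i * y ord0 i.
  rewrite !sqr_enorm mulr_sumr -!big_split/=.
  by apply: eq_bigr => i _; rewrite mxE; ring.
have := enorm_Cauchy_Schwarz x y; lra.
Qed.

Lemma enorm_dist_triangle {R : realType} {d : nat} (z x y : 'rV[R]_d) :
  enorm (x - y) <= enorm (x - z) + enorm (z - y).
Proof.
have -> : x - y = (x - z) + (z - y) by rewrite subrKA.
exact: enorm_triangle.
Qed.

Lemma eball_sub {R : realType} {d : nat} (x y : 'rV[R]_d) (r t : R) :
  enorm (x - y) + r <= t -> eball x r `<=` eball y t.
Proof.
move=> xyrt z /=; have := enorm_dist_triangle x z y.
rewrite /eball/=; lra.
Qed.

Lemma cube_enorm {R : realType} {d : nat} (a x y : 'rV[R]_d) (l : R) :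
  0 <= l -> cube a l x -> cube a l y -> enorm (x - y) <= Num.sqrt d%:R * l.
Proof.
move=> l0 ax ay; rewrite -[l in leRHS]ger0_norm// -sqrtr_sqr -sqrtrM ?ler0n//.
rewrite ler_wsqrtr// (@le_trans _ _ (\sum_(i < d) l ^+ 2))//; last first.
  by rewrite sumr_const card_ord mulr_natl.
apply: ler_sum => i _; rewrite !mxE -ler_sqrt ?sqr_ge0// !sqrtr_sqr.
have /andP[? ?] := ax i; have /andP[? ?] := ay i.
rewrite (ger0_norm l0) ler_norml; apply/andP; split; lra.
Qed.

Lemma compact_cube {R : realType} {d : nat} (a : 'rV[R]_d) (l : R) :
  compact (cube a l).
Proof.
have := @rV_compact R d (fun i => `[a ord0 i, a ord0 i + l]%classic)
  (fun i => @segment_compact R _ _).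
by congr compact.
Qed.

(** Row vectors carry the topology of the sup norm, so continuity of the Euclidean distance is
    checked through coordinates. It makes Euclidean balls Borel. *)
Lemma continuous_enorm_dist {R : realType} {d : nat} (x : 'rV[R]_d) :
  continuous (fun y : 'rV[R]_d => enorm (x - y)).
Proof.
move=> y; pose f (z : 'rV[R]_d) : R := \sum_(i < d) (x - z) ord0 i ^+ 2.
suff fy : {for y, continuous f}.
  exact: (continuous_comp fy (@sqrt_continuous R (f y))).
have H i : true -> (x - z) ord0 i ^+ 2 @[z --> y] --> (x - y) ord0 i ^+ 2.
  move=> _; apply: (@continuous_comp _ _ _ (fun z : 'rV[R]_d => (x - z) ord0 i)
    (fun t : R => t ^+ 2)); last exact: exprn_continuous.
  have -> : (fun z : 'rV[R]_d => (x - z) ord0 i) = (fun z => x ord0 i - z ord0 i).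
    by apply/funext => z; rewrite !mxE.
  exact: (cvgB (cvg_cst (x ord0 i)) (@coord_continuous R 1 d ord0 i y)).
exact: (cvg_big (@add_continuous R^o) (nbhs_filter y) H).
Qed.

Lemma measurable_enorm_dist {R : realType} {d : nat} (x : 'rV[R]_d) :
  measurable_fun [set: BorelRd R d] (fun y : BorelRd R d => enorm (x - y)).
Proof.
apply: (measurability _ (RGenInftyO.measurableE R)).
move=> _ [_ [p ->] <-].
rewrite setTI; apply: sub_sigma_algebra.
move: (@continuous_enorm_dist R d x) => /continuousP; apply.
exact: interval_open.
Qed.

Lemma measurable_eball {R : realType} {d : nat} (x : 'rV[R]_d) (r : R) :
  measurable (eball x r : set (BorelRd R d)).
Proof.
have -> : eball x r = [set: BorelRd R d] `&`
    (fun y : BorelRd R d => enorm (x - y)) @^-1` `]-oo, r[%classic.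
  by apply/seteqP; split => y; rewrite /eball/= in_itv/= enorm_distC// => -[].
by apply: measurable_enorm_dist => //; exact: measurable_itv.
Qed.

Lemma measurable_riesz_kernel {R : realType} {d : nat} (alpha : R) (x : 'rV[R]_d) :
  measurable_fun [set: BorelRd R d] (riesz_kernel alpha x).
Proof.
apply/measurable_EFinP; apply: (measurableT_comp (measurable_powR _)).
exact: measurable_enorm_dist.
Qed.

(** * Nonnegative series and Hausdorff content *)

Lemma nneseries_ge_term {R : realType} (u : nat -> \bar R) (j : nat) :
  (forall n, 0 <= u n)%E -> (u j <= \sum_(n <oo) u n)%E.
Proof.
move=> u0; by rewrite (nneseriesD1 (n := j))// leeDl// nneseries_ge0.
Qed.

Lemma nneseries_geometric {R : realType} (a q : R) : 0 <= a -> 0 <= q < 1 ->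
  (\sum_(n <oo) (a * q ^+ n)%:E = (a / (1 - q))%:E)%E.
Proof.
move=> a0 /andP[q0 q1].
have qn : `|q| < 1 by rewrite ger0_norm.
apply/cvg_lim => //; have := @cvg_geometric_series R a q qn.
move=> aq; apply: cvg_EFin; first by apply: nearW => n; rewrite sumEFin.
apply: cvg_trans aq; apply: near_eq_cvg; apply: nearW => n.
by rewrite /= sumEFin.
Qed.

Lemma omega_ge0 {R : realType} (b : R) : 0 <= omega b.
Proof.
rewrite mulr_ge0 ?powR_ge0 ?invr_ge0// fine_ge0// integral_ge0// => t _.
by rewrite lee_fin mulr_ge0 ?powR_ge0 ?expR_ge0.
Qed.

Lemma hcontent_ge0 {R : realType} {d : nat} (b : R) (E : set 'rV[R]_d) :
  (0 <= hcontent b E)%E.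
Proof.
apply: le_ereal_inf_tmp => _ [c [_ [_ ->]]]; apply: nneseries_ge0 => n _ _.
by rewrite lee_fin mulr_ge0 ?omega_ge0 ?powR_ge0.
Qed.

Lemma le_hcontent {R : realType} {d : nat} (b : R) (E F : set 'rV[R]_d) :
  E `<=` F -> (hcontent b E <= hcontent b F)%E.
Proof.
move=> EF; apply: ereal_inf_le_tmp => _ [c [c0 [Fc ->]]].
by exists c; split => //; split => //; exact: subset_trans Fc.
Qed.

(* Radii [0] pad the finite cover to a countable one: [eball z 0] is empty
   and contributes nothing to the sum since [powR 0 b = 0] for [b > 0]. *)
Lemma hcontent_finite_cover {R : realType} {d : nat} (b r : R)
    (E : set 'rV[R]_d) (s : seq 'rV[R]_d) : 0 < b -> 0 <= r ->
  (forall x, E x -> exists2 z, z \in s & eball z r x) ->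
  (hcontent b E <= ((size s)%:R * (omega b * powR r b))%:E)%E.
Proof.
move=> b0 r0 Es; apply: ereal_inf_lbound.
exists (fun i => (nth 0 s i, if (i < size s)%N then r else 0)); split.
  by move=> i /=; case: ifP.
split.
  move=> x /Es[z zs zx]; exists (index z s) => //=.
  by rewrite index_mem zs nth_index.
rewrite (nneseries_split 0 (size s)) => [|k _]; last first.
  by rewrite lee_fin mulr_ge0 ?omega_ge0 ?powR_ge0.
rewrite [X in (_ + X)%E]eseries0 => [|i]; last first.
  by rewrite add0n => ? _ /=; rewrite ltnNge (_ : _ <= _)%N//= powR0 ?gt_eqF// mulr0.
rewrite adde0 add0n sumEFin; congr (_%:E).
rewrite big_nat (eq_bigr (fun=> omega b * powR r b)).
  by rewrite -big_nat sumr_const_nat subn0 mulr_natl.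
by move=> i /andP[_ ->].
Qed.

Lemma hcontent0 {R : realType} {d : nat} (b : R) : 0 < b ->
  hcontent b (set0 : set 'rV[R]_d) = 0%E.
Proof.
move=> b0; apply/eqP; rewrite eq_le hcontent_ge0 andbT.
have := @hcontent_finite_cover R d b 0 set0 [::] b0 (lexx _).
by rewrite mul0r; apply.
Qed.

(** If all contents are finite, take for each [E j] a cover optimal up to [e / 2 ^ j.+1], and merge
    the covers into one sequence along a bijection of [nat] with [nat * nat]. *)
Lemma hcontent_bigcup {R : realType} {d : nat} (b : R)
    (E : nat -> set 'rV[R]_d) :
  (hcontent b (\bigcup_j E j) <= \sum_(j <oo) hcontent b (E j))%E.
Proof.
have [[j Ej]|] := pselect (exists j, hcontent b (E j) = +oo%E).
  by rewrite (nneseries_pinfty _ _ Ej) ?leey// => n _; exact: hcontent_ge0.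
rewrite -forallNE => Efin.
apply/lee_addgt0Pr => e e0.
apply: le_trans (epsilon_trick xpredT (fun j => hcontent_ge0 b (E j)) (ltW e0)).
pose P j (c : nat -> 'rV[R]_d * R) := [/\ forall i, 0 <= (c i).2,
   E j `<=` \bigcup_i eball (c i).1 (c i).2 &
   (\sum_(i <oo) (omega b * powR (c i).2 b)%:E <=
     hcontent b (E j) + (e / (2 ^ j.+1)%:R)%:E)%E].
have [c Pc] : {c & forall j, P j (c j)}.
  apply: (@choice _ _ P) => j.
  have ej : 0 < e / (2 ^ j.+1)%:R by rewrite divr_gt0// ltr0n expn_gt0.
  have Ejfin : hcontent b (E j) \is a fin_num.
    by rewrite ge0_fin_numE ?hcontent_ge0// ltey; exact/eqP/Efin.
  have [_ [c [c0 [Ejc ->]]] cE] := lb_ereal_inf_adherent ej Ejfin.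
  by exists c; split => //; exact: ltW.
have /card_esym/ppcard_eqP[f] := card_nat2.
pose a (ij : nat * nat) := (omega b * powR (c ij.1 ij.2).2 b)%:E.
have a0 ij : (0 <= a ij)%E by rewrite lee_fin mulr_ge0 ?omega_ge0 ?powR_ge0.
apply: (@le_trans _ _ (\sum_(n <oo) a (f n))%E).
  apply: ereal_inf_lbound; exists (fun n => c (f n).1 (f n).2); split.
    by move=> n; have [] := Pc (f n).1.
  split => // x [j _ Ejx]; have [_ /(_ x Ejx)[i _ ix] _] := Pc j.
  by exists (f^-1%FUN (j, i)) => //=; rewrite invK ?inE.
have <- : (\esum_(ij in [set: nat * nat]) a ij = \sum_(n <oo) a (f n))%E.
  by rewrite nneseries_esumT//; exact: reindex_esum.
rewrite [X in esum X _](_ : _ = [set: nat] `*`` (fun=> [set: nat])); last first.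
  by apply/seteqP; split.
rewrite -(esum_esum (a := fun i j => a (i, j)))//.
rewrite -nneseries_esumT => [|n]; last exact: esum_ge0.
apply: lee_nneseries => [i _ _|i _]; first exact: esum_ge0.
by rewrite -nneseries_esumT//; have [] := Pc i.
Qed.

(** * Packing and covering *)

(** Balls of radius [r] about [2 * r]-separated points of [E] are disjoint, lie in [B] and have mass
    at least [t], so there are at most [V / t] of them. A separated family of maximal size therefore
    exists, and doubling its balls covers [E]. *)
Lemma maximal_separated_cover {R : realType} {d : nat}
    (S : {measure set BorelRd R d -> \bar R}) (E B : set 'rV[R]_d) (r t V : R) :
  measurable (B : set (BorelRd R d)) -> 0 < t -> (S B <= V%:E)%E ->
  (forall x, E x -> eball x r `<=` B /\ (t%:E <= S (eball x r))%E) ->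
  exists2 s : seq 'rV[R]_d, (size s)%:R * t <= V &
    forall x, E x -> exists2 z, z \in s & eball z (2 * r) x.
Proof.
move=> mB t0 SBV EB.
pose sep := pairwise (fun x y : 'rV[R]_d => 2 * r <= enorm (x - y)).
pose U (s : seq 'rV[R]_d) : set (BorelRd R d) :=
  [set y | exists2 z, z \in s & eball z r y].
have Ucons x s : U (x :: s) = eball x r `|` U s.
  apply/seteqP; split => [y [z]|y [xy|[z zs zy]]].
  - by rewrite inE => /predU1P[->|zs] zy; [left|right; exists z].
  - by exists x; rewrite ?mem_head.
  - by exists z; rewrite // inE zs orbT.
have mU s : measurable (U s).
  elim: s => [|x s IH]; last by rewrite Ucons; apply: measurableU => //;
    exact: measurable_eball.
  by rewrite (_ : U [::] = set0)//; apply/seteqP; split => y // [].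
have bound s : sep s -> (forall x, x \in s -> E x) -> (size s)%:R * t <= V.
  move=> seps sE; rewrite -lee_fin; apply: le_trans SBV.
  apply: (@le_trans _ _ (S (U s))); last first.
    apply: le_measure; rewrite ?inE//.
    by move=> y [z zs zy]; exact: (EB z (sE z zs)).1.
  elim: s seps sE => [_ _|x s IH]; first by rewrite mul0r.
  rewrite /sep pairwise_cons => /andP[/allP xs seps] sE.
  rewrite Ucons measureU//; last 2 first.
  - exact: measurable_eball.
  - apply/seteqP; split => y // -[/= xy [z zs zy]].
    have := xs z zs; have := enorm_dist_triangle y x z.
    rewrite (enorm_distC x y); move: xy zy; rewrite /eball/=; lra.
  rewrite -natr1 mulrDl mul1r EFinD addeC leeD//.
    by apply: (EB x _).2; apply: sE; rewrite mem_head.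
  by apply: IH => // z zs; apply: sE; rewrite inE zs orbT.
pose P n := `[< exists s, [/\ size s = n, sep s & forall x, x \in s -> E x] >].
have P0 : exists n, P n by exists 0; apply/asboolP; exists [::].
have V0 : 0 <= V by rewrite -lee_fin; apply: le_trans SBV; exact: measure_ge0.
have Pub n : P n -> (n <= Num.truncn (V / t))%N.
  move=> /asboolP[s [<- seps sE]].
  by rewrite truncn_ge_nat ?divr_ge0// ?(ltW t0)// ler_pdivlMr ?bound.
case: (ex_maxnP P0 Pub) => n /asboolP[s [sn seps sE]] nmax.
exists s; first exact: bound.
move=> x Ex; apply: contrapT => xs.
(* A point missed by all the doubled balls could be added to the family. *)
suff /nmax : P n.+1 by rewrite ltnn.
apply/asboolP; exists (x :: s); split => /=; first by rewrite sn.
  apply/andP; split => //.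
  by apply/allP => z zs; rewrite leNgt; apply/negP => zx; apply: xs; exists z.
by move=> z; rewrite inE => /predU1P[->//|/sE].
Qed.

(** * Weighted series of indicators, the form of all dyadic majorants below *)

Lemma series_indic_ge0 {T : Type} {R : realType} (a : nat -> R)
    (A : nat -> set T) (x : T) : (forall k, 0 <= a k) ->
  (0 <= \sum_(k <oo) (a k * \1_(A k) x)%:E)%E.
Proof. by move=> a0; apply: nneseries_ge0 => k _ _; rewrite lee_fin mulr_ge0. Qed.

Lemma series_indic_ge_term {T : Type} {R : realType} (a : nat -> R)
    (A : nat -> set T) (x : T) (j : nat) : (forall k, 0 <= a k) -> A j x ->
  ((a j)%:E <= \sum_(k <oo) (a k * \1_(A k) x)%:E)%E.
Proof.
move=> a0 Ajx; apply: le_trans (nneseries_ge_term _ j _) => /=.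
  by rewrite indicE mem_set// mulr1.
by move=> k; rewrite lee_fin mulr_ge0.
Qed.

Lemma measurable_series_indic {dsp : measure_display} {T : measurableType dsp}
    {R : realType} (D : set T) (a : nat -> R) (A : nat -> set T) :
  (forall k, 0 <= a k) -> (forall k, measurable (A k)) ->
  measurable_fun D (fun x => \sum_(k <oo) (a k * \1_(A k) x)%:E)%E.
Proof.
move=> a0 mA; apply: (ge0_emeasurable_sum (P := xpredT)).
  by move=> k x _ _; rewrite lee_fin mulr_ge0.
by move=> k _; apply/measurable_EFinP; exact: measurable_funM.
Qed.

Lemma integral_series_indic {dsp : measure_display} {T : measurableType dsp}
    {R : realType} (mu : {measure set T -> \bar R}) (D : set T)
    (a : nat -> R) (A : nat -> set T) :
  measurable D -> (forall k, 0 <= a k) -> (forall k, measurable (A k)) ->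
  (\int[mu]_(x in D) (\sum_(k <oo) (a k * \1_(A k) x)%:E) =
   \sum_(k <oo) (a k)%:E * mu (A k `&` D))%E.
Proof.
move=> mD a0 mA; rewrite integral_nneseries//; last 2 first.
- by move=> k; apply/measurable_EFinP; exact: measurable_funM.
- by move=> k x _; rewrite lee_fin mulr_ge0.
apply: eq_eseriesr => k _; under eq_integral do rewrite EFinM.
rewrite ge0_integralZl_EFin ?integral_indic//.
by apply/measurable_EFinP; exact: measurable_indic.
Qed.

(** * Dyadic bounds for the kernel *)

Lemma exists_lt_exp2 {R : realType} (v : R) : exists n, v < 2 ^+ n.
Proof.
exists (Num.truncn v).+1; apply: lt_trans (truncnS_gt v) _.
by rewrite -natrX ltr_nat ltn_expl.
Qed.

Lemma le_powRN {R : realType} (a b s : R) : 0 < a -> a <= b -> 0 <= s ->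
  powR b (- s) <= powR a (- s).
Proof.
move=> a0 ab s0; have b0 := lt_le_trans a0 ab.
rewrite !powRN lef_pV2 ?posrE ?powR_gt0// ge0_ler_powR// ?nnegrE; exact: ltW.
Qed.

(** Mean value inequality, obtained without derivatives: for [a <= b], the bounds [ln (1 + u) <= u]
    and [1 + u <= expR u] give [1 - s * (b / a - 1) <= powR (b / a) (- s)]. *)
Lemma powRN_dist {R : realType} (a b c s : R) : 0 < c -> c <= a -> c <= b ->
  0 <= s ->
  `|powR a (- s) - powR b (- s)| <= s * powR c (- s - 1) * `|a - b|.
Proof.
move=> c0 + + s0; wlog ab : a b / a <= b => [wlg|ca cb].
  have [ab|/ltW ba] := leP a b; first exact: wlg.
  by move=> ca cb; rewrite distrC (distrC a); exact: wlg.
have a0 := lt_le_trans c0 ca; have b0 := lt_le_trans c0 cb.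
rewrite ger0_norm ?subr_ge0 ?le_powRN// distrC ger0_norm ?subr_ge0//.
have ba0 : 0 < b / a by rewrite divr_gt0.
have lnba : ln (b / a) <= b / a - 1.
  by rewrite -[X in ln X](subrKC 1); apply: le_ln1Dx; lra.
have ba : powR b (- s) = powR a (- s) * powR (b / a) (- s).
  by rewrite -powRM ?(ltW a0) ?(ltW ba0)// mulrC divfK// gt_eqF.
have exp_ba : 1 - s * (b / a - 1) <= powR (b / a) (- s).
  rewrite /powR (gt_eqF ba0); apply: le_trans (expR_ge1Dx _).
  by rewrite mulNr lerD2l lerN2 ler_wpM2l.
apply: (@le_trans _ _ (s * powR a (- s - 1) * (b - a))); last first.
  rewrite ler_wpM2r ?subr_ge0// ler_wpM2l//.
  by rewrite -opprD le_powRN// addr_ge0.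
rewrite ba -{1}[powR a (- s)]mulr1 -mulrBr.
rewrite powRB ?(gt_eqF a0) ?implybT// powRr1 ?(ltW a0)//.
rewrite [leRHS](_ : _ = powR a (- s) * (s * (b / a - 1))).
  by rewrite ler_wpM2l ?powR_ge0//; lra.
by field; rewrite gt_eqF.
Qed.

(** The term whose dyadic shell contains [y] already dominates the kernel. On the diagonal the
    kernel is 0, since [powR 0 (- s) = 0] for nonzero [s]. *)
Lemma near_kernel_le {R : realType} {d : nat} (s r : R) (x y : 'rV[R]_d) :
  0 < s -> 0 < r -> enorm (x - y) < r ->
  ((powR (enorm (x - y)) (- s))%:E <=
   \sum_(j <oo) (powR (r / 2 ^+ j.+1) (- s) * \1_(eball x (r / 2 ^+ j)) y)%:E)%E.
Proof.
move=> s0 r0 xyr; have := enorm_ge0 (x - y).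
rewrite le_eqVlt => /predU1P[<-|xy0].
  rewrite powR0 ?oppr_eq0 ?gt_eqF//; apply: series_indic_ge0 => j.
  exact: powR_ge0.
have exj : exists n, r / 2 ^+ n.+1 <= enorm (x - y).
  have [n rn] := exists_lt_exp2 (r / enorm (x - y)); exists n.
  rewrite ler_pdivrMr ?exprn_gt0// mulrC -ler_pdivrMr// exprS.
  have : 0 < 2 ^+ n :> R by exact: exprn_gt0.
  lra.
case: (ex_minnP exj) => n rn nmin.
apply: (@le_trans _ _ (powR (r / 2 ^+ n.+1) (- s))%:E).
  by rewrite lee_fin le_powRN ?(ltW s0)// divr_gt0// exprn_gt0.
apply: (@series_indic_ge_term _ _ (fun j => powR (r / 2 ^+ j.+1) (- s))
  (fun j => eball x (r / 2 ^+ j))) => [k|]; first exact: powR_ge0.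
rewrite /eball/= enorm_distC.
(* For [n = 0] the ball has radius [r], so the hypothesis suffices; otherwise minimality of [n] puts
   [y] in the ball. *)
case: n nmin {rn} => [|n] nmin; first by rewrite expr0 divr1.
by rewrite ltNge; apply/negP => /nmin; rewrite ltnn.
Qed.

(** If [2 ^+ k * r <= enorm (x0 - y) < 2 ^+ k.+1 * r], both distances to [y] are at least
    [2 ^+ k * r / 2] and differ by at most [r / 2]; the mean value inequality then gives the k-th
    term. *)
Lemma far_kernel_le {R : realType} {d : nat} (s r : R) (x x0 y : 'rV[R]_d) :
  0 < s -> 0 < r -> enorm (x - x0) <= r / 2 -> r <= enorm (x0 - y) ->
  (`|powR (enorm (x - y)) (- s) - powR (enorm (x0 - y)) (- s)|%:E <=
   \sum_(k <oo) (s * powR (2 ^+ k * r / 2) (- s - 1) * (r / 2) *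
                 \1_(eball x0 (2 ^+ k.+1 * r)) y)%:E)%E.
Proof.
move=> s0 r0 xx0 ry.
have exk : exists n, enorm (x0 - y) < 2 ^+ n.+1 * r.
  have [n rn] := exists_lt_exp2 (enorm (x0 - y) / r); exists n.
  rewrite -ltr_pdivrMr// exprS.
  have : 0 < 2 ^+ n :> R by exact: exprn_gt0.
  lra.
case: (ex_minnP exk) => k yk kmin.
have ky : 2 ^+ k * r <= enorm (x0 - y).
  case: k kmin {yk} => [|k] kmin; first by rewrite expr0 mul1r.
  by rewrite leNgt; apply/negP => /kmin; rewrite ltnn.
have b0 j : 0 <= s * powR (2 ^+ j * r / 2) (- s - 1) * (r / 2).
  by rewrite mulr_ge0 ?divr_ge0 ?mulr_ge0 ?powR_ge0 ?(ltW s0) ?(ltW r0).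
apply: le_trans (series_indic_ge_term _ (fun k => eball x0 (2 ^+ k.+1 * r)) y k
  b0 _); last by rewrite /eball/= enorm_distC.
have k1 : 1 <= 2 ^+ k :> R by rewrite exprn_ege1// ler1n.
have kr : r <= 2 ^+ k * r by rewrite ler_peMl// ltW.
have t1 := enorm_dist_triangle x x0 y.
have t2 := enorm_dist_triangle x0 x y.
rewrite (enorm_distC x0 x) in t1.
rewrite lee_fin; apply: le_trans (@powRN_dist _ _ _ (2 ^+ k * r / 2) _ _ _ _ _) _.
- lra.
- lra.
- lra.
- exact: ltW.
rewrite ler_wpM2l ?mulr_ge0 ?powR_ge0 ?(ltW s0)//.
rewrite ler_norml; apply/andP; split; lra.
Qed.

(** * Pointwise oscillation of the potential *)

Lemma le_integralD_ge0 {dsp : measure_display} {T : measurableType dsp}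
    {R : realType} (mu : {measure set T -> \bar R}) (f g h : T -> \bar R) :
  measurable_fun [set: T] f -> measurable_fun [set: T] g ->
  measurable_fun [set: T] h ->
  (forall x, 0 <= f x)%E -> (forall x, 0 <= g x)%E -> (forall x, 0 <= h x)%E ->
  (forall x, f x <= g x + h x)%E ->
  (\int[mu]_x f x <= \int[mu]_x g x + \int[mu]_x h x)%E.
Proof.
move=> mf mg mh f0 g0 h0 fgh; rewrite -ge0_integralD//.
by apply: ge0_le_integral => //; exact: emeasurable_funD.
Qed.

(** [P] and [N] may be infinite, but then so is [hp] or [hn], because [p] and [n] are finite, and
    the right-hand side is [+oo]. *)
Lemma abse_scaled_difference_le {R : realType} (g : R) (P N p n hp hn : \bar R) :
  0 < g -> p \is a fin_num -> n \is a fin_num ->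
  (0 <= P)%E -> (0 <= N)%E -> (0 <= hp)%E -> (0 <= hn)%E ->
  (P <= p + hp)%E -> (p <= P + hp)%E -> (N <= n + hn)%E -> (n <= N + hn)%E ->
  (`|g%:E * (P - N) - (g * (fine p - fine n))%:E| <= g%:E * (hp + hn))%E.
Proof.
move=> g0.
case: p => [p| |]// _; case: n => [n| |]// _ P0 N0.
case: hp => [hp| |]//; last by case: hn => [hn| |]//= *;
  rewrite ?addye// gt0_muley ?lte_fin// leey.
case: hn => [hn| |]//; last by move=> *; rewrite addey// gt0_muley ?lte_fin// leey.
case: P P0 => [P| |]// P0; case: N N0 => [N| |]// N0 _ _.
rewrite -!EFinD !lee_fin => Pp pP Nn nN.
rewrite /= -mulrBr normrM (gtr0_norm g0) ler_wpM2l ?(ltW g0)//.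
rewrite ler_norml; apply/andP; split; lra.
Qed.

Lemma riesz_const_ge0 {R : realType} (d : nat) (alpha : R) :
  0 <= riesz_const d alpha.
Proof.
have gamma_ge0 (s : R) : 0 <= gammaR s.
  rewrite fine_ge0// integral_ge0// => t _.
  by rewrite lee_fin mulr_ge0 ?powR_ge0 ?expR_ge0.
by rewrite /riesz_const !mulr_ge0 ?powR_ge0 ?invr_ge0.
Qed.

(** By convention [+oo - +oo] is [-oo], so a finite difference of nonnegative integrals has both
    terms finite. *)
Lemma riesz_potential_fin {R : realType} {d : nat} (alpha : R)
    (mup mun : {measure set BorelRd R d -> \bar R}) (x : 'rV[R]_d) :
  0 < (riesz_const d alpha)^-1 -> riesz_potential alpha mup mun x \is a fin_num ->
  (\int[mup]_y riesz_kernel alpha x y)%E \is a fin_num /\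
  (\int[mun]_y riesz_kernel alpha x y)%E \is a fin_num.
Proof.
move=> g0; rewrite /riesz_potential.
have : (0 <= \int[mup]_y riesz_kernel alpha x y)%E.
  by apply: integral_ge0 => y _; rewrite lee_fin powR_ge0.
have : (0 <= \int[mun]_y riesz_kernel alpha x y)%E.
  by apply: integral_ge0 => y _; rewrite lee_fin powR_ge0.
case: (integral _ _ _) => [P| |]//; case: (integral _ _ _) => [N| |]// _ _.
- by rewrite /= addye// gt0_muley.
- by rewrite /= addeNy gt0_muleNy.
- by rewrite /= addeNy gt0_muleNy.
Qed.

Lemma riesz_potential_oscillation {R : realType} {d : nat} (alpha s r : R)
    (mup mun : {measure set BorelRd R d -> \bar R}) (x0 : 'rV[R]_d) :
  let S := measure_add mup mun in
  0 < s -> alpha = d%:R - s -> 0 < r ->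
  riesz_potential alpha mup mun x0 \is a fin_num ->
  exists c : R, forall x, enorm (x - x0) <= r / 2 ->
    (`|riesz_potential alpha mup mun x - c%:E| <= (riesz_const d alpha)^-1%:E *
      (\sum_(j <oo) (powR (2 * r / 2 ^+ j.+1) (- s))%:E *
                    S (eball x (2 * r / 2 ^+ j)) +
       \sum_(k <oo) (s * powR (2 ^+ k * r / 2) (- s - 1) * (r / 2))%:E *
                    S (eball x0 (2 ^+ k.+1 * r))))%E.
Proof.
move=> S s0 alphaE r0 Ix0.
(* If the factor in front of the potential is 0, the potential vanishes and [c = 0] works. *)
have := riesz_const_ge0 d alpha; rewrite -invr_ge0 le_eqVlt => /predU1P[g0|g0].
  exists 0 => x _; rewrite /riesz_potential -g0 !mul0e sube0 abse0.
  exact: lexx.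
have [Pfin Nfin] := riesz_potential_fin _ _ _ _ g0 Ix0.
(* The kernel at [x0] cut off inside [eball x0 r]; its integrals define [c]. The majorant [h] bounds
   the difference to the kernel at [x]: its first series serves [y] inside the ball, its second [y]
   outside. *)
pose k0 (y : BorelRd R d) : \bar R :=
  (powR (enorm (x0 - y)) (- s) * \1_(~` eball x0 r) y)%:E.
pose a j := powR (2 * r / 2 ^+ j.+1) (- s).
pose b k := s * powR (2 ^+ k * r / 2) (- s - 1) * (r / 2).
pose h x (y : BorelRd R d) : \bar R :=
  (\sum_(j <oo) (a j * \1_(eball x (2 * r / 2 ^+ j)) y)%:E +
   \sum_(k <oo) (b k * \1_(eball x0 (2 ^+ k.+1 * r)) y)%:E)%E.
have a0 j : 0 <= a j by exact: powR_ge0.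
have b0 k : 0 <= b k.
  by rewrite mulr_ge0 ?divr_ge0 ?mulr_ge0 ?powR_ge0 ?(ltW s0) ?(ltW r0).
have kE (x y : 'rV[R]_d) : riesz_kernel alpha x y = (powR (enorm (x - y)) (- s))%:E.
  by rewrite /riesz_kernel alphaE addrAC subrr sub0r.
have mk x := @measurable_riesz_kernel R d alpha x.
have k_ge0 (x y : 'rV[R]_d) : (0 <= riesz_kernel alpha x y)%E by rewrite lee_fin powR_ge0.
have mk0 : measurable_fun [set: BorelRd R d] k0.
  apply/measurable_EFinP; apply: measurable_funM; last first.
    by apply: measurable_indic; apply: measurableC; exact: measurable_eball.
  apply: (measurableT_comp (measurable_powR _)).
  exact: measurable_enorm_dist.
have k0_ge0 y : (0 <= k0 y)%E by rewrite lee_fin mulr_ge0 ?powR_ge0.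
have m1 x := @measurable_series_indic _ (BorelRd R d) R setT a
  (fun j => eball x (2 * r / 2 ^+ j)) a0 (fun j => measurable_eball _ _).
have m2 := @measurable_series_indic _ (BorelRd R d) R setT b
  (fun k => eball x0 (2 ^+ k.+1 * r)) b0 (fun j => measurable_eball _ _).
have mh x : measurable_fun [set: BorelRd R d] (h x) by exact: emeasurable_funD.
have h_ge0 (x y : 'rV[R]_d) : (0 <= h x y)%E by rewrite adde_ge0// series_indic_ge0.
have kh (x y : 'rV[R]_d) : enorm (x - x0) <= r / 2 ->
    (riesz_kernel alpha x y <= k0 y + h x y)%E /\
    (k0 y <= riesz_kernel alpha x y + h x y)%E.
  move=> xx0; rewrite !kE.
  have [ry|yr] := leP r (enorm (x0 - y)).
    have -> : k0 y = (powR (enorm (x0 - y)) (- s))%:E.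
      rewrite /k0 indicE mem_set ?mulr1// /eball/= enorm_distC; apply/negP.
      by rewrite -leNgt.
    have := far_kernel_le _ _ _ _ _ s0 r0 xx0 ry; rewrite -/(b _) => far.
    have {}far : (`|powR (enorm (x - y)) (- s) - powR (enorm (x0 - y)) (- s)|%:E
        <= h x y)%E.
      by apply: le_trans far _; rewrite leeDr// series_indic_ge0.
    split; apply: le_trans (leeD2l _ far); rewrite -EFinD lee_fin.
      by have := ler_norm (powR (enorm (x - y)) (- s) - powR (enorm (x0 - y)) (- s)); lra.
    rewrite distrC.
    by have := ler_norm (powR (enorm (x0 - y)) (- s) - powR (enorm (x - y)) (- s)); lra.
  have -> : k0 y = 0%E.
    rewrite /k0 indicE memNset ?mulr0// => /=; apply.
    by rewrite /eball/= enorm_distC.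
  split; last by rewrite adde_ge0// lee_fin powR_ge0.
  (* The near series starts at radius [2 * r], since [enorm (x - y) < r / 2 + r]. *)
  have r20 : 0 < 2 * r by lra.
  have xy2 : enorm (x - y) < 2 * r.
    by have := enorm_dist_triangle x0 x y; lra.
  rewrite add0e; apply: le_trans (near_kernel_le _ _ _ _ s0 r20 xy2) _.
  by rewrite leeDl// series_indic_ge0.
(* Here the finiteness of the potential at [x0] enters: [k0] is at most the kernel at [x0]. *)
have k0_fin (mu : {measure set BorelRd R d -> \bar R}) :
    (\int[mu]_y riesz_kernel alpha x0 y)%E \is a fin_num ->
    (\int[mu]_y k0 y)%E \is a fin_num.
  rewrite !ge0_fin_numE; [|exact: integral_ge0..].
  apply: le_lt_trans; apply: ge0_le_integral => // y _.
  by rewrite kE lee_fin ler_piMr ?powR_ge0// indicE lern1 leq_b1.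
exists ((riesz_const d alpha)^-1 *
  (fine (\int[mup]_y k0 y) - fine (\int[mun]_y k0 y))) => x xx0.
have -> : (\sum_(j <oo) (a j)%:E * S (eball x (2 * r / 2 ^+ j)) +
    \sum_(k <oo) (b k)%:E * S (eball x0 (2 ^+ k.+1 * r)) =
    \int[mup]_y h x y + \int[mun]_y h x y)%E.
  rewrite -ge0_integral_measure_add// ge0_integralD//; last 2 first.
  - by move=> y _; exact: series_indic_ge0.
  - by move=> y _; exact: series_indic_ge0.
  rewrite !integral_series_indic//; [|by move=> k; exact: measurable_eball..].
  by congr (_ + _)%E; apply: eq_eseriesr => k _; rewrite setIT.
apply: abse_scaled_difference_le => //; try exact: k0_fin; try exact: integral_ge0.
all: apply: le_integralD_ge0 => // y.
- exact: (kh x y xx0).1.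
- exact: (kh x y xx0).2.
- exact: (kh x y xx0).1.
- exact: (kh x y xx0).2.
Qed.

(** * From decay of level sets to the Choquet integral *)

(** The content at height [t] is dominated by a staircase, of value [V / 4 ^+ k] for [t] below
    [2 ^+ k.+1 * T]. The integrals of the steps are [2 * T * V / 2 ^+ k], with sum [4 * T * V]. *)
Lemma choquet_le {R : realType} {d : nat} (b T V : R) (Q : set 'rV[R]_d)
    (f : 'rV[R]_d -> \bar R) : 0 < T -> (hcontent b Q <= V%:E)%E ->
  (forall lam, 1 <= lam ->
    (hcontent b [set x | Q x /\ ((lam * T)%:E < f x)%E] <= (V / lam ^+ 2)%:E)%E) ->
  (choquet b Q f <= (4 * T * V)%:E)%E.
Proof.
move=> T0 QV fV.
pose H t := hcontent b [set x | Q x /\ (t%:E < f x)%E].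
have V0 : 0 <= V by rewrite -lee_fin (le_trans _ QV)// hcontent_ge0.
have HV t : (H t <= V%:E)%E by apply: le_trans QV; apply: le_hcontent => x [].
have H0 t : (0 <= H t)%E by exact: hcontent_ge0.
have Hfin t : H t \is a fin_num.
  by rewrite ge0_fin_numE// (le_lt_trans (HV t))// ltry.
have mH : measurable_fun (`[0, +oo[%classic : set R) H.
  have -> : H = EFin \o (fine \o H) by apply/funext => t /=; rewrite fineK.
  apply/measurable_EFinP; apply: nonincreasing_measurable => // t u tu.
  rewrite fine_le//; apply: le_hcontent => x [Qx ux]; split => //.
  by apply: le_lt_trans ux; rewrite lee_fin.
pose a k : R := V / 4 ^+ k.
pose A k : set R := `[0, 2 ^+ k.+1 * T[%classic.
have a0 k : 0 <= a k by rewrite divr_ge0// exprn_ge0.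
have mA k : measurable (A k) by exact: measurable_itv.
have HA t : `[0, +oo[%classic t -> (H t <= \sum_(k <oo) (a k * \1_(A k) t)%:E)%E.
  rewrite /= in_itv/= andbT => t0.
  have exk : exists n, t < 2 ^+ n.+1 * T.
    have [n tn] := exists_lt_exp2 (t / T); exists n.
    rewrite -ltr_pdivrMr// exprS.
    have : 0 < 2 ^+ n :> R by exact: exprn_gt0.
    lra.
  case: (ex_minnP exk) => k tk kmin.
  apply: le_trans (series_indic_ge_term a A t k a0 _); last first.
    by rewrite /A/= in_itv/= t0.
  (* Heights below [2 * T] use the trivial bound [V]; above, the decay is applied with
     [lam = 2 ^+ k.+1]. *)
  case: k kmin {tk} => [|k] kmin; first by rewrite /a expr0 divr1.
  have kt : 2 ^+ k.+1 * T <= t.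
    by rewrite leNgt; apply/negP => /kmin; rewrite ltnn.
  have := fV (2 ^+ k.+1); rewrite exprn_ege1 ?ler1n// => /(_ isT).
  rewrite -exprM mulnC exprM (_ : 2 ^+ 2 = 4 :> R); last by ring.
  apply: le_trans; apply: le_hcontent => x [Qx tx]; split => //.
  by apply: le_lt_trans tx; rewrite lee_fin.
apply: (@le_trans _ _ (\int[@lebesgue_measure R]_(t in `[0%R, +oo[)
    (\sum_(k <oo) (a k * \1_(A k) t)%:E))%E).
  apply: ge0_le_integral => //.
  - by move=> t _; exact: H0.
  - exact: (measurable_series_indic _ a A a0 mA).
rewrite integral_series_indic//.
rewrite (eq_eseriesr (g := fun k => (2 * T * V * 2^-1 ^+ k)%:E)); last first.
  move=> k _; rewrite setIidl; last first.
    by move=> t; rewrite /A/= !in_itv/= andbT => /andP[].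
  have AT : (@lebesgue_measure R (A k) = (2 ^+ k.+1 * T)%:E)%E.
    by rewrite /A lebesgue_measure_itv/= lte_fin mulr_gt0 ?exprn_gt0// sube0.
  rewrite [X in (_ * X)%E]AT -EFinM.
  congr (_%:E); rewrite /a exprS (_ : 4 = 2 * 2 :> R); last by ring.
  rewrite exprMn exprVn; field.
  by rewrite expf_neq0.
rewrite nneseries_geometric ?mulr_ge0 ?(ltW T0)//; last by lra.
by rewrite lee_fin le_eqVlt; apply/orP; left; apply/eqP; field.
Qed.

(** * Geometric sums over scales and content of the level sets *)

Lemma powR2N_itv {R : realType} (e : R) : 0 < e -> 0 < powR 2 (- e) < 1.
Proof.
move=> e0; rewrite powR_gt0//= powRN invf_lt1 ?powR_gt0//.
rewrite -[ltLHS](_ : powR 1 e = 1); last by rewrite powR1.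
rewrite gt0_ltr_powR ?nnegrE//; lra.
Qed.

(** Applied with [e = eps / 3] and [n = 2], to read the power [eps] of a dyadic radius as the cube
    of [p ^+ j]. *)
Lemma powR_div_exp2 {R : realType} (r e : R) (j n : nat) : 0 <= r ->
  powR (r / 2 ^+ j) (n.+1%:R * e) = powR r (n.+1%:R * e) * (powR 2 (- e) ^+ j) ^+ n.+1.
Proof.
move=> r0; rewrite powRM ?invr_ge0 ?exprn_ge0//; congr (_ * _).
have -> : powR (2 ^+ j)^-1 (n.+1%:R * e) = powR 2 (- j%:R * (n.+1%:R * e)) :> R.
  by rewrite [RHS]powRrM powR_invn.
have -> : (powR 2 (- e) ^+ j) ^+ n.+1 = powR 2 (- e * (j * n.+1)%:R) :> R.
  by rewrite powRrM powR_mulrn ?powR_ge0// exprM.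
by congr powR; rewrite natrM; ring.
Qed.

Lemma powRN_powRM {R : realType} (u c s : R) : 0 < u -> 0 <= c ->
  powR u (- s) * powR (c * u) s = powR c s.
Proof.
move=> u0 c0; rewrite powRM ?(ltW u0)// powRN mulrCA mulVf ?mulr1//.
by rewrite gt_eqF// powR_gt0.
Qed.

(** The radius in the bound on [v j] is twice the one in the weight, so the powers of the radius
    cancel up to [powR 2 s] and a geometric series in [p] is left. *)
Lemma near_sum_le {R : realType} (s r lam m p : R) (v : nat -> \bar R) :
  0 < r -> 0 <= lam -> 0 <= m -> 0 <= p < 1 -> (forall j, 0 <= v j)%E ->
  (forall j, v j <= (lam * m * p ^+ j * powR (2 * r / 2 ^+ j) s)%:E)%E ->
  (\sum_(j <oo) (powR (2 * r / 2 ^+ j.+1) (- s))%:E * v j <=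
   (powR 2 s * lam * m / (1 - p))%:E)%E.
Proof.
move=> r0 lam0 m0 p01 v0 vle.
rewrite -nneseries_geometric ?mulr_ge0 ?powR_ge0//.
apply: lee_nneseries => [j _ _|j _]; first by rewrite mule_ge0 ?lee_fin ?powR_ge0.
apply: le_trans (lee_wpmul2l _ (vle j)) _; first by rewrite lee_fin powR_ge0.
rewrite -EFinM lee_fin le_eqVlt; apply/orP; left; apply/eqP.
have u0 : 0 < 2 * r / 2 ^+ j.+1 by rewrite divr_gt0 ?mulr_gt0// exprn_gt0.
rewrite (_ : 2 * r / 2 ^+ j = 2 * (2 * r / 2 ^+ j.+1)); last first.
  by rewrite exprS; field; rewrite expf_neq0.
rewrite mulrCA powRN_powRM//; ring.
Qed.

(** With [u = 2 ^+ k * r / 2] the ball has radius [4 * u], and the k-th term is at most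
    [s * powR 4 s * m / 2 ^+ k]. The decay comes from the extra power of [u] in the mean value
    inequality. *)
Lemma far_sum_le {R : realType} (s r m : R) (v : nat -> \bar R) :
  0 < s -> 0 < r -> 0 <= m -> (forall k, 0 <= v k)%E ->
  (forall k, v k <= (m * powR (2 ^+ k.+1 * r) s)%:E)%E ->
  (\sum_(k <oo) (s * powR (2 ^+ k * r / 2) (- s - 1) * (r / 2))%:E * v k <=
   (2 * s * powR 4 s * m)%:E)%E.
Proof.
move=> s0 r0 m0 v0 vle.
have -> : 2 * s * powR 4 s * m = s * powR 4 s * m / (1 - 2^-1) by field.
have c0 k : 0 <= s * powR (2 ^+ k * r / 2) (- s - 1) * (r / 2).
  by rewrite mulr_ge0 ?divr_ge0 ?mulr_ge0 ?powR_ge0 ?(ltW s0) ?(ltW r0).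
rewrite -nneseries_geometric ?mulr_ge0 ?powR_ge0 ?(ltW s0)//; last by lra.
apply: lee_nneseries => [k _ _|k _]; first by rewrite mule_ge0// lee_fin.
apply: le_trans (lee_wpmul2l _ (vle k)) _; first by rewrite lee_fin.
rewrite -EFinM lee_fin le_eqVlt; apply/orP; left; apply/eqP.
have u0 : 0 < 2 ^+ k * r / 2 by rewrite divr_gt0 ?mulr_gt0// exprn_gt0.
rewrite powRB ?(gt_eqF u0) ?implybT// powRr1 ?(ltW u0)//.
rewrite (_ : 2 ^+ k.+1 * r = 4 * (2 ^+ k * r / 2)); last by rewrite exprS; field.
rewrite -(powRN_powRM _ 4 s u0)// exprVn; field.
by rewrite (gt_eqF r0) expf_neq0.
Qed.

(* [n * t <= V] separated points at scale [2 * r / 2 ^+ j] cover the j-th level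
   set; the loss [(p ^+ j)^-1] in the threshold is paid by the extra power
   [eps] in the content, as [(2 ^- j) `^ eps = p ^+ (3 * j)].  The growth
   condition makes the level set empty unless [lam * p ^+ j < 1], which trades
   one more factor [p ^+ j] for [lam^-1]. *)
Lemma level_content_le {R : realType} {d : nat} (s eps r m lam : R)
    (S : {measure set BorelRd R d -> \bar R}) (x0 : 'rV[R]_d) (Q : set 'rV[R]_d) :
  let p := powR 2 (- (eps / 3)) in
  0 < s -> 0 < eps -> 0 < r -> 0 < m -> 1 <= lam ->
  (forall x t, 0 < t -> (S (eball x t) <= (m * powR t s)%:E)%E) ->
  (forall x, Q x -> enorm (x - x0) <= r / 2) ->
  (hcontent (s + eps) [set x | Q x /\ exists j,
     ((lam * m * p ^+ j * powR (2 * r / 2 ^+ j) s)%:E <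
      S (eball x (2 * r / 2 ^+ j)))%E] <=
   (omega (s + eps) * powR 2 (s + eps) * powR 3 s * powR 2 eps / (1 - p) *
    powR r (s + eps) / lam ^+ 2)%:E)%E.
Proof.
move=> p s0 eps0 r0 m0 lam1 Sm Qx0.
have lam0 : 0 < lam by lra.
have /andP[p0 p1] : 0 < p < 1 by apply: powR2N_itv; lra.
set b := s + eps; have b0 : 0 < b by exact: addr_gt0.
pose K := omega b * powR 2 b * powR 3 s * powR 2 eps * powR r b / lam ^+ 2.
have K0 : 0 <= K.
  apply: divr_ge0; last by rewrite exprn_ge0 ?(ltW lam0).
  by do 4 (apply: mulr_ge0; last exact: powR_ge0); exact: omega_ge0.
pose E j := [set x | Q x /\ ((lam * m * p ^+ j * powR (2 * r / 2 ^+ j) s)%:E <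
      S (eball x (2 * r / 2 ^+ j)))%E].
rewrite (_ : [set x | _] = \bigcup_j E j); last first.
  apply/seteqP; split => [x [Qx [j xj]]|x [j _ [Qx xj]]]; first by exists j.
  by split => //; exists j.
rewrite (_ : _ / lam ^+ 2 = K / (1 - p)); last first.
  by rewrite /K; field; rewrite subr_eq0 (gt_eqF p1) (gt_eqF lam0).
apply: le_trans (hcontent_bigcup b E) _.
rewrite -nneseries_geometric ?(ltW p0)//.
apply: lee_nneseries => [j _ _|j _]; first exact: hcontent_ge0.
set rj := 2 * r / 2 ^+ j.
have rj0 : 0 < rj by rewrite divr_gt0 ?mulr_gt0// exprn_gt0.
have P0 : 0 < p ^+ j by exact: exprn_gt0.
have rjs0 : 0 < powR rj s by exact: powR_gt0.
have [lamP|lamP] := leP 1 (lam * p ^+ j).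
  have -> : E j = set0.
    apply/seteqP; split => // x [Qx]; apply/negP; rewrite -leNgt.
    apply: le_trans (Sm x _ rj0) _; rewrite lee_fin ler_pM2r//.
    by rewrite mulrAC -[leLHS]mul1r ler_pM2r.
  by rewrite hcontent0// lee_fin mulr_ge0// ltW.
pose V := m * powR (3 * r) s.
have t0 : 0 < lam * m * p ^+ j * powR rj s by rewrite !mulr_gt0.
have SV : (S (eball x0 (3 * r)) <= V%:E)%E by apply: Sm; lra.
have rjr : rj <= 2 * r.
  rewrite ler_pdivrMr ?exprn_gt0// ler_peMr ?exprn_ege1 ?ler1n//.
  by rewrite mulr_ge0// ltW.
(* The inclusion holds as [r / 2 + 2 * r <= 3 * r]. *)
have EB x : E j x -> eball x rj `<=` eball x0 (3 * r) /\
    ((lam * m * p ^+ j * powR rj s)%:E <= S (eball x rj))%E.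
  move=> [Qx /ltW xj]; split => //; apply: eball_sub.
  have := Qx0 x Qx; lra.
have [z nV zE] := maximal_separated_cover S _ _ _ _ _
  (measurable_eball x0 (3 * r)) t0 SV EB.
have rj2 : 0 <= 2 * rj by lra.
apply: le_trans (hcontent_finite_cover _ _ _ _ b0 rj2 zE) _.
rewrite lee_fin.
set n := (size z)%:R in nV *; have n0 : 0 <= n by rewrite ler0n.
have -> : powR (2 * rj) b = powR 2 b * powR rj s * (powR (2 * r) eps * (p ^+ j) ^+ 3).
  rewrite powRM ?(ltW rj0)// -mulrA; congr (_ * _).
  rewrite /b powRD ?(gt_eqF rj0) ?implybT//; congr (_ * _).
  have -> : eps = 2.+1%:R * (eps / 3) by field.
  by rewrite powR_div_exp2 ?mulr_ge0 ?(ltW r0).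
have nle : n * powR rj s <= powR (3 * r) s / (lam * p ^+ j).
  rewrite ler_pdivlMr ?mulr_gt0// -(ler_pM2l m0).
  by apply: le_trans nV; rewrite le_eqVlt; apply/orP; left; apply/eqP; ring.
apply: (@le_trans _ _ (omega b * powR 2 b * powR (2 * r) eps * (p ^+ j) ^+ 3 *
    (powR (3 * r) s / (lam * p ^+ j)))).
  rewrite [leLHS](_ : _ = omega b * powR 2 b * powR (2 * r) eps * (p ^+ j) ^+ 3 *
    (n * powR rj s)); last by ring.
  apply: ler_wpM2l nle; apply: mulr_ge0; last by rewrite !exprn_ge0// ltW.
  by do 2 (apply: mulr_ge0; last exact: powR_ge0); exact: omega_ge0.
rewrite [leLHS](_ : _ = K * p ^+ j * (lam * p ^+ j)).
  by apply: ler_piMr; [apply: mulr_ge0 => //|]; exact: ltW.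
rewrite /K !powRM ?(ltW r0)// [powR r b]powRD ?(gt_eqF r0) ?implybT//.
by field; rewrite (gt_eqF lam0) (gt_eqF P0).
Qed.

(** Off the level sets the near sum is linear in [lam] and the far sum is at most [lam] times its
    bound, as [1 <= lam]. The oscillation is thus at most [lam] times a fixed height, in which the
    summand 1 ensures positivity. The summand [omega (s + eps)] accounts for covering [Q] by one
    ball. *)
Lemma riesz_choquet_oscillation {R : realType} {d : nat} (alpha s eps r m : R)
    (mup mun : {measure set BorelRd R d -> \bar R}) (x0 : 'rV[R]_d)
    (Q : set 'rV[R]_d) :
  let p := powR 2 (- (eps / 3)) in
  let K := omega (s + eps) * powR 2 (s + eps) * powR 3 s * powR 2 eps / (1 - p) in
  let g := (riesz_const d alpha)^-1 in
  0 < s -> alpha = d%:R - s -> 0 < eps -> 0 < r -> 0 < m ->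
  (forall x t, 0 < t ->
    (mup (eball x t) + mun (eball x t) <= (m * powR t s)%:E)%E) ->
  (forall x, Q x -> enorm (x - x0) <= r / 2) ->
  riesz_potential alpha mup mun x0 \is a fin_num ->
  exists c : R,
    (choquet (s + eps) Q (fun x => `|riesz_potential alpha mup mun x - c%:E|) <=
     (4 * ((g * (powR 2 s / (1 - p) + 2 * s * powR 4 s) + 1) * m) *
      ((K + omega (s + eps)) * powR r (s + eps)))%:E)%E.
Proof.
move=> p K g s0 alphaE eps0 r0 m0 Sm Qx0 Ix0.
have /andP[p0 p1] : 0 < p < 1 by apply: powR2N_itv; lra.
have g0 : 0 <= g by rewrite invr_ge0 riesz_const_ge0.
have K0 : 0 <= K.
  apply: divr_ge0; last by rewrite subr_ge0 ltW.
  by do 3 (apply: mulr_ge0; last exact: powR_ge0); exact: omega_ge0.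
have b0 : 0 < s + eps by exact: addr_gt0.
have [c Ic] := riesz_potential_oscillation _ _ _ mup mun x0 s0 alphaE r0 Ix0.
exists c.
set Cn := powR 2 s / (1 - p); set Cf := 2 * s * powR 4 s.
have Cn0 : 0 <= Cn by rewrite divr_ge0 ?powR_ge0// subr_ge0 ltW.
have Cf0 : 0 <= Cf by rewrite !mulr_ge0 ?powR_ge0// ltW.
have T0 : 0 < (g * (Cn + Cf) + 1) * m.
  by rewrite mulr_gt0// ltr_wpDl// mulr_ge0// addr_ge0.
pose S := [the measure _ _ of measure_add mup mun].
have SE A : S A = (mup A + mun A)%E by exact: measure_addE.
have {}Sm x t : 0 < t -> (S (eball x t) <= (m * powR t s)%:E)%E.
  by rewrite SE; exact: Sm.
apply: choquet_le => //.
  have := @hcontent_finite_cover R d (s + eps) r Q [:: x0] b0 (ltW r0).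
  rewrite mul1r => H; apply: le_trans (H _) _.
    move=> x Qx; exists x0; rewrite ?mem_head//.
    by have := Qx0 x Qx; rewrite /eball/=; lra.
  by rewrite lee_fin ler_wpM2r ?powR_ge0// lerDr.
move=> lam lam1.
have lam0 : 0 < lam by lra.
apply: le_trans (le_hcontent _ _ _ _) (le_trans (level_content_le s eps r m lam S
  x0 Q s0 eps0 r0 m0 lam1 Sm Qx0) _); last first.
  rewrite -/p -/K lee_fin ler_pM2r ?invr_gt0 ?exprn_gt0//.
  by rewrite ler_wpM2r ?powR_ge0// lerDl omega_ge0.
move=> x [Qx Ix]; split => //; apply: contrapT => /forallNP xj.
move: Ix; apply/negP; rewrite -leNgt.
apply: le_trans (Ic x (Qx0 x Qx)) _.
have near : (\sum_(j <oo) (powR (2 * r / 2 ^+ j.+1) (- s))%:E *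
    S (eball x (2 * r / 2 ^+ j)) <= (powR 2 s * lam * m / (1 - p))%:E)%E.
  apply: near_sum_le => //; rewrite ?(ltW lam0) ?(ltW m0) ?(ltW p0)//.
  by move=> j; rewrite leNgt; exact/negP/xj.
have far : (\sum_(k <oo) (s * powR (2 ^+ k * r / 2) (- s - 1) * (r / 2))%:E *
    S (eball x0 (2 ^+ k.+1 * r)) <= (Cf * m)%:E)%E.
  apply: far_sum_le; rewrite ?(ltW m0)// => k.
  by apply: Sm; rewrite mulr_gt0// exprn_gt0.
apply: le_trans (lee_wpmul2l _ (leeD near far)) _; first by rewrite lee_fin.
rewrite -EFinD -EFinM lee_fin.
rewrite (_ : powR 2 s * lam * m / (1 - p) = lam * (Cn * m)); last by rewrite /Cn; ring.
have gCf : 0 <= g * (Cf * m) by rewrite !mulr_ge0// ltW.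
have : g * (Cf * m) <= lam * (g * (Cf * m)) by rewrite ler_peMl.
have : 0 <= lam * m by rewrite mulr_ge0 ?(ltW lam0) ?(ltW m0).
rewrite /g; lra.
Qed.

(** * Cubes without a point of finiteness, and the estimate on cubes *)

(** Every level set is [Q], so the integral is the content of [Q] times the infinite length of the
    half-line. *)
Lemma choquet_infinite {R : realType} {d : nat} (b : R) (Q : set 'rV[R]_d)
    (f : 'rV[R]_d -> \bar R) : (forall x, Q x -> f x = +oo%E) ->
  (choquet b Q f < +oo)%E -> hcontent b Q = 0%E.
Proof.
move=> fQ; rewrite /choquet (eq_integral (cst (hcontent b Q))); last first.
  move=> t _; congr hcontent; apply/seteqP; split => x; first by case.
  by move=> Qx; split => //; rewrite fQ// ltry.
have muoo : (@lebesgue_measure R `[0%R, +oo[%classic = +oo)%E.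
  by rewrite lebesgue_measure_itv/= ltry.
rewrite integral_cst// [X in (_ * X)%E]muoo.
have := hcontent_ge0 b Q; rewrite le_eqVlt => /predU1P[<-//|Q0].
by rewrite gt0_muley.
Qed.

Lemma choquet_null {R : realType} {d : nat} (b : R) (Q : set 'rV[R]_d)
    (f : 'rV[R]_d -> \bar R) : hcontent b Q = 0%E -> choquet b Q f = 0%E.
Proof.
move=> Q0; rewrite /choquet; apply: integral0_eq => t _.
apply/eqP; rewrite eq_le hcontent_ge0 andbT -Q0.
by apply: le_hcontent => x [].
Qed.

Theorem theorem1p8 (R : realType) (d : nat) (alpha eps : R) :
  0 < alpha -> alpha < d%:R -> 0 < eps -> eps <= alpha ->
  exists C : R, 0 < C /\
    forall mup mun : {measure set BorelRd R d -> \bar R},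
      signed_radon mup mun ->
      (morrey_norm (d%:R - alpha) mup mun < +oo)%E ->
      (forall K : set 'rV[R]_d, compact K ->
         L1_content (d%:R - alpha + eps) K (riesz_potential alpha mup mun)) ->
      (bmo_norm (d%:R - alpha + eps) (riesz_potential alpha mup mun)
         <= C%:E * morrey_norm (d%:R - alpha) mup mun)%E.
Proof.
move=> alpha0 alphad eps0 _.
set s := d%:R - alpha; set b := s + eps.
have s0 : 0 < s by rewrite subr_gt0.
have alphaE : alpha = d%:R - s by rewrite subKr.
have d0 : 0 < Num.sqrt d%:R :> R by rewrite sqrtr_gt0 (lt_trans alpha0).
pose p : R := powR 2 (- (eps / 3)).
have /andP[p0 p1] : 0 < p < 1 by apply: powR2N_itv; rewrite divr_gt0.
pose K := omega b * powR 2 b * powR 3 s * powR 2 eps / (1 - p) + omega b.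
pose G := (riesz_const d alpha)^-1 * (powR 2 s / (1 - p) + 2 * s * powR 4 s) + 1.
have K0 : 0 <= K.
  apply: addr_ge0; last exact: omega_ge0.
  apply: divr_ge0; last by rewrite subr_ge0 ltW.
  by do 3 (apply: mulr_ge0; last exact: powR_ge0); exact: omega_ge0.
have G0 : 0 < G.
  rewrite ltr_wpDl// mulr_ge0 ?invr_ge0 ?riesz_const_ge0// addr_ge0//.
    by rewrite divr_ge0 ?powR_ge0// subr_ge0 ltW.
  by rewrite !mulr_ge0 ?powR_ge0// ltW.
(* The power converts [r] into the side length; the added 1 makes [C] positive. *)
pose C := 4 * G * K * powR (2 * Num.sqrt d%:R) b + 1.
have C0 : 0 < C by rewrite ltr_wpDl// !mulr_ge0 ?powR_ge0// ltW.
exists C; split => // mup mun _ Mfin IL1.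
set M := morrey_norm s mup mun in Mfin *.
have leM x r : 0 < r ->
    ((mup (eball x r) + mun (eball x r)) * (powR r (- s))%:E <= M)%E.
  by move=> r0; apply: ereal_sup_ubound; exists x, r.
have M0 : (0 <= M)%E.
  apply: le_trans (leM 0 1 ltr01); apply: mule_ge0.
    by apply: adde_ge0; exact: measure_ge0.
  by rewrite lee_fin powR_ge0.
have MfinE : M = (fine M)%:E by rewrite fineK// ge0_fin_numE.
have fM0 : 0 <= fine M by exact: fine_ge0.
apply: ge_ereal_sup => _ [a [l [l0 ->]]].
apply/lee_addgt0Pr => e e0.
have [[x0 [ax0 Ix0]]|noQ] := pselect (exists x0, cube a l x0 /\
    riesz_potential alpha mup mun x0 \is a fin_num); last first.
  have Q0 : hcontent b (cube a l) = 0%E.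
    apply: (@choquet_infinite _ _ _ _ (fun x => `|riesz_potential alpha mup mun x|%E)).
      move=> x ax; have : riesz_potential alpha mup mun x \isn't a fin_num.
        by apply/negP => xfin; apply: noQ; exists x.
      by case: (riesz_potential alpha mup mun x).
    exact: (IL1 (cube a l) (compact_cube a l)).2.
  apply: (@le_trans _ _ 0%E); last first.
    by rewrite adde_ge0 ?mule_ge0 ?lee_fin ?(ltW C0) ?(ltW e0).
  by apply: ereal_inf_lbound; exists 0; rewrite choquet_null// mule0.
(* The Morrey norm may be 0 while the level set estimate needs [0 < m]; with this choice [C * m] is
   [C * fine M + e]. *)
pose m := fine M + e / C.
have m0 : 0 < m by rewrite ltr_wpDl// divr_gt0.
have Sm x t : 0 < t ->
    (mup (eball x t) + mun (eball x t) <= (m * powR t s)%:E)%E.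
  move=> t0; have ts0 : 0 < powR t s by exact: powR_gt0.
  have := leM x t t0; rewrite powRN => leMt.
  have -> : (mup (eball x t) + mun (eball x t) =
    (mup (eball x t) + mun (eball x t)) * (powR t s)^-1%:E * (powR t s)%:E)%E.
    by rewrite -muleA -EFinM mulVf ?gt_eqF// mule1.
  rewrite EFinM lee_wpmul2r ?lee_fin ?(ltW ts0)//.
  by apply: le_trans leMt _; rewrite MfinE lee_fin lerDl divr_ge0 ?ltW.
pose r := 2 * (Num.sqrt d%:R * l).
have r0 : 0 < r by rewrite !mulr_gt0.
have Qx0 x : cube a l x -> enorm (x - x0) <= r / 2.
  move=> ax; apply: le_trans (cube_enorm _ _ _ _ (ltW l0) ax ax0) _.
  by rewrite /r mulrAC divff// mul1r.
have [c Ic] := riesz_choquet_oscillation alpha s eps r m mup mun x0 (cube a l)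
  s0 alphaE eps0 r0 m0 Sm Qx0 Ix0.
apply: (@le_trans _ _ ((powR l (- b))%:E *
    choquet b (cube a l) (fun x => `|riesz_potential alpha mup mun x - c%:E|))%E).
  by apply: ereal_inf_lbound; exists c.
apply: le_trans (lee_wpmul2l _ Ic) _; first by rewrite lee_fin powR_ge0.
rewrite -/b -/p -/K -/G MfinE -!EFinM -EFinD lee_fin.
have -> : powR r b = powR (2 * Num.sqrt d%:R) b * powR l b.
  by rewrite /r mulrA powRM ?(ltW l0)// mulr_ge0 ?sqrtr_ge0.
have lb0 : 0 < powR l b by exact: powR_gt0.
rewrite powRN [leLHS](_ : _ = (C - 1) * m); last first.
  by rewrite /C; field; rewrite gt_eqF.
rewrite [leRHS](_ : _ = C * m); last by rewrite /m; field; rewrite gt_eqF.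
by rewrite ler_wpM2r ?(ltW m0)// gerBl.
Qed.
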